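(* Let $\mathbf{S}=(S_{\boldsymbol{\alpha}})_{\boldsymbol{\alpha}}$ be an optimal solution of the $r$-th order correlative sparsity adapted moment relaxation (with optimal value $\lambda_r^{(\mathrm{cs})}$), $r\ge r_{\min}$, of the polynomial matrix optimization problem with optimal value $\lambda^\star$. If $\mathrm{rank}\,M_{r_{\min}}(\mathbf{S},\mathcal{I}_\ell)=1$ for each $\ell\in[t]$, then $\lambda_r^{(\mathrm{cs})}=\lambda^\star$. Moreover, one can recover an optimal solution of the polynomial matrix optimization problem.
   Context: **Problem.** $\lambda^\star:=\inf_{\boldsymbol{x}\in\mathbb{R}^n}\lambda_{\min}(F(\boldsymbol{x}))$ s.t. $G_1(\boldsymbol{x})\succeq0,\ldots,G_m(\boldsymbol{x})\succeq0$, where $F$ is a symmetric $p\times p$ real polynomial matrix, $G_k$ a symmetric $q_k\times q_k$ real polynomial matrix, and $\lambda_{\min}$ is the smallest eigenvalue. An optimal solution is a feasible point $\boldsymbol{x}$ with $\lambda_{\min}(F(\boldsymbol{x}))=\lambda^\star$. Set $d_k=\lceil\deg G_k/2\rceil$ (degree = maximum degree of entries), $r_{\min}=\max\{\lceil\deg F/2\rceil,d_1,\ldots,d_m\}$, $[t]=\{1,\ldots,t\}$, $|\boldsymbol{\alpha}|=\sum_i\alpha_i$, $\mathbb{N}^n_d=\{\boldsymbol{\alpha}\in\mathbb{N}^n:|\boldsymbol{\alpha}|\le d\}$. For a multi-index, $\mathrm{supp}(\boldsymbol{\alpha})=\{k:\alpha_k\ne0\}$. Write $F=\sum_{\boldsymbol{\alpha}}F_{\boldsymbol{\alpha}}\boldsymbol{x}^{\boldsymbol{\alpha}}$,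 $G_k=\sum_{\boldsymbol{\gamma}}(G_k)_{\boldsymbol{\gamma}}\boldsymbol{x}^{\boldsymbol{\gamma}}$ with matrix coefficients. **Correlative sparsity.** The correlative sparsity pattern graph has vertex set $[n]$; $i,j$ are adjacent if $i,j\in\mathrm{supp}(\boldsymbol{\alpha})$ for some $\boldsymbol{\alpha}$ with $F_{\boldsymbol{\alpha}}\neq0$, or if $x_i,x_j$ both effectively occur in some $G_k$. $\mathcal{I}_1,\ldots,\mathcal{I}_t$ are its maximal cliques. $\mathcal{J}_1,\ldots,\mathcal{J}_t$ are pairwise disjoint subsets of $[m]$ with union $[m]$ such that for $k\in\mathcal{J}_\ell$ all variables of $G_k$ have index in $\mathcal{I}_\ell$. **Relaxation.** For $\mathbf{S}=(S_{\boldsymbol{\alpha}})_{\boldsymbol{\alpha}\in\mathbb{N}^n_{2r}}$ with $S_{\boldsymbol{\alpha}}$ real symmetric $p\times p$, $\mathscr{L}_{\mathbf{S}}(F)=\sum_{\boldsymbol{\alpha}}\mathrm{tr}(F_{\boldsymbol{\alpha}}S_{\boldsymbol{\alpha}})$. For $\mathcal{I}\subseteq[n]$, $M_d(\mathbf{S},\mathcal{I})$ is the block matrix with blocks indexed by $\boldsymbol{\alpha},\boldsymbol{\beta}\in\mathbb{N}^n_d$ with supports in $\mathcal{I}$, whose $(\boldsymbol{\alpha},\boldsymbol{\beta})$ block is $S_{\boldsymbol{\alpha}+\boldsymbol{\beta}}$; $M_d(G\mathbf{S},\mathcal{I})$ is the analogous block matrix with blocks $\sum_{\boldsymbol{\gamma}}S_{\boldsymbol{\alpha}+\boldsymbol{\beta}+\boldsymbol{\gamma}}\otimes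 G_{\boldsymbol{\gamma}}$. The $r$-th order relaxation is $$\lambda_r^{(\mathrm{cs})}:=\inf_{\mathbf{S}}\ \mathscr{L}_{\mathbf{S}}(F)\ \text{ s.t. } M_r(\mathbf{S},\mathcal{I}_\ell)\succeq0\ (\ell\in[t]),\ M_{r-d_k}(G_k\mathbf{S},\mathcal{I}_\ell)\succeq0\ (k\in\mathcal{J}_\ell,\ \ell\in[t]),\ \mathscr{L}_{\mathbf{S}}(I_p)=1.$$ *)

(* Defs.v *)
From mathcomp Require Import all_boot all_order all_algebra.
(* [mpoly] has to be imported before [boolp]: in the other order its notations
   are rejected by the parser. *)
From mathcomp Require Import mpoly.
From mathcomp Require Import boolp classical_sets reals constructive_ereal ereal.
From mathcomp Require Import mxtens.

Set Implicit Arguments.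
Unset Strict Implicit.
Unset Printing Implicit Defensive.

Import Order.TTheory GRing.Theory Num.Theory.
Local Open Scope ring_scope.

Definition symmetric_mx (T : Type) (k : nat) (A : 'M[T]_k) : Prop := A^T = A.

Definition psd (R : realType) (k : nat) (A : 'M[R]_k) : Prop :=
  symmetric_mx A /\ forall v : 'cV[R]_k, 0 <= (v^T *m A *m v) 0 0.

(* A real symmetric matrix of positive size has finitely many eigenvalues, and
   at least one, so that this infimum is their minimum. *)
Definition lambda_min (R : realType) (k : nat) (A : 'M[R]_k) : R :=
  inf [set a : R | eigenvalue A a]%classic.

Section PolynomialMatrices.
Variables (R : realType) (n k : nat).
Implicit Types (A : 'M[{mpoly R[n]}]_k) (I : {set 'I_n}).

Definition pmx_eval A (x : 'rV[R]_n) : 'M[R]_k := map_mx (meval (x 0)) A.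

Definition pmx_coeff A (a : 'X_{1..n}) : 'M[R]_k := map_mx (mcoeff a) A.

(* [msize] is the total degree plus one, and is 0 for the zero polynomial, whose
   degree is thus taken to be 0. *)
Definition pmx_deg A : nat := (\max_(i < k) \max_(j < k) (msize (A i j)).-1)%N.

Definition mnm_supp (a : 'X_{1..n}) : {set 'I_n} := [set i | a i != 0%N].

Definition occurs A (i : 'I_n) : Prop :=
  exists a : 'X_{1..n}, pmx_coeff A a != 0 /\ i \in mnm_supp a.

(* multi-indices of degree at most d with support in I *)
Definition monomials (d : nat) I : {set 'X_{1..n < d.+1}} :=
  [set a : 'X_{1..n < d.+1} | mnm_supp a \subset I].

End PolynomialMatrices.

Section Problem.
Variables (R : realType) (n m p : nat) (q : 'I_m -> nat).
Variables (F : 'M[{mpoly R[n]}]_p) (G : forall k : 'I_m, 'M[{mpoly R[n]}]_(q k)).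

Definition feasible (x : 'rV[R]_n) : Prop :=
  forall k : 'I_m, psd (pmx_eval (G k) x).

Definition lambda_star : \bar R :=
  ereal_inf [set (lambda_min (pmx_eval F x))%:E | x in feasible]%classic.

Definition optimal_point (x : 'rV[R]_n) : Prop :=
  feasible x /\ (lambda_min (pmx_eval F x))%:E = lambda_star.

Definition half_deg (k : 'I_m) : nat := uphalf (pmx_deg (G k)).

Definition r_min : nat := maxn (uphalf (pmx_deg F)) (\max_(k < m) half_deg k)%N.

Definition csp_adj (i j : 'I_n) : Prop :=
  i <> j /\
  ((exists a : 'X_{1..n},
      [/\ pmx_coeff F a != 0, i \in mnm_supp a & j \in mnm_supp a]) \/
   (exists k : 'I_m, occurs (G k) i /\ occurs (G k) j)).

Definition csp_clique (C : {set 'I_n}) : Prop :=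
  forall i j, i \in C -> j \in C -> i <> j -> csp_adj i j.

Definition csp_maximal_clique (C : {set 'I_n}) : Prop :=
  csp_clique C /\
  forall D : {set 'I_n}, csp_clique D -> C \subset D -> D = C.

Definition enumerates_maximal_cliques (t : nat) (I : 'I_t -> {set 'I_n}) : Prop :=
  injective I /\ forall C, csp_maximal_clique C <-> exists l, C = I l.

(* The parts [J l] may be empty. *)
Definition constraint_assignment (t : nat)
    (I : 'I_t -> {set 'I_n}) (J : 'I_t -> {set 'I_m}) : Prop :=
  [/\ forall l l', l != l' -> [disjoint J l & J l'],
      \bigcup_(l < t) J l = [set: 'I_m] &
      forall l k, k \in J l -> forall i, occurs (G k) i -> i \in I l].

End Problem.

Section MomentRelaxation.
Variables (R : realType) (n p r : nat).

(* families (S_a) of p x p matrices indexed by the multi-indices a of degree at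
   most 2r *)
Definition moments : Type := {ffun 'X_{1..n < (2 * r).+1} -> 'M[R]_p}.

Variable S : moments.

(* S_a, extended by 0 to the multi-indices of degree greater than 2r so that it
   can be used on sums of multi-indices *)
Definition moment (a : 'X_{1..n}) : 'M[R]_p :=
  if insub a is Some b then S b else 0.

Definition riesz (A : 'M[{mpoly R[n]}]_p) : R :=
  \sum_(a : 'X_{1..n < (2 * r).+1}) \tr (pmx_coeff A a *m moment a).

Definition moment_mx (d : nat) (I : {set 'I_n}) :=
  \mxblock_(a < #|monomials d I|, b < #|monomials d I|)
    moment (enum_val a + enum_val b)%MM.

Definition localizing_mx (k : nat) (A : 'M[{mpoly R[n]}]_k)
    (d : nat) (I : {set 'I_n}) :=
  \mxblock_(a < #|monomials d I|, b < #|monomials d I|)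
    \sum_(c : 'X_{1..n < (pmx_deg A).+1})
      (moment (enum_val a + enum_val b + c)%MM *t pmx_coeff A c).

(* The point read off from the first-order moments, x_i = tr S_(e_i), which is
   L_S(x_i I_p). For r = 0 there are no such moments and the point is 0. *)
Definition recovered_point : 'rV[R]_n := \row_i \tr (moment U_(i)%MM).

End MomentRelaxation.

Section SparseRelaxation.
Variables (R : realType) (n m p t : nat) (q : 'I_m -> nat).
Variables (F : 'M[{mpoly R[n]}]_p) (G : forall k : 'I_m, 'M[{mpoly R[n]}]_(q k)).
Variables (I : 'I_t -> {set 'I_n}) (J : 'I_t -> {set 'I_m}) (r : nat).

Definition cs_feasible (S : moments R n p r) : Prop :=
  [/\ forall a, symmetric_mx (S a),
      forall l, psd (moment_mx S r (I l)),
      forall l k, k \in J l ->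
        psd (localizing_mx S (G k) (r - half_deg G k) (I l)) &
      riesz S 1%:M = 1].

Definition lambda_cs : \bar R :=
  ereal_inf [set (riesz S F)%:E | S in cs_feasible]%classic.

Definition cs_optimal (S : moments R n p r) : Prop :=
  cs_feasible S /\ (riesz S F)%:E = lambda_cs.

End SparseRelaxation.

(* Main.v *)
(** Rank one of [M_(r_min)(S, I_l)] means that its 2 x 2 minors vanish. Since [tr S_0 = 1],
    summing these minors gives [S_(a+b) = S_a S_b] and [S_a = tr(S_a) S_0], so [P = S_0]
    is a symmetric projection of trace 1 and [S_a = x^a P] whenever [|a| <= 2 r_min] and
    the support of [a] lies in a clique, [x] being read off the first-order moments. Hence
    the (0, 0) block of each localizing matrix is the Kronecker product of [P] and [G_k(x)],
    which makes [x] feasible, and [L_S(F) = tr(F(x) P) >= lambda_min(F(x)) >= lambda*].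
    Conversely the moments [x^a u u^T], for [x] feasible and [u] a unit eigenvector for
    [lambda_min(F(x))], are feasible in the relaxation, so that [lambda_cs <= lambda*]. *)
Require Import Defs.
From mathcomp Require Import all_boot all_order all_algebra.
From mathcomp Require Import mpoly.
From mathcomp Require Import boolp classical_sets reals constructive_ereal ereal.
From mathcomp Require Import mxtens.
From mathcomp Require Import zify ring lra.

Import Order.TTheory GRing.Theory Num.Theory.
Local Open Scope ring_scope.

(** * Quadratic forms, smallest eigenvalues and positive semidefiniteness *)

Section QuadraticForms.
Set Implicit Arguments.
Unset Strict Implicit.
Variable R : realType.

Definition quad_form k (A : 'M[R]_k) (v : 'cV[R]_k) : R := (v^T *m A *m v) 0 0.

Definition sqnorm k (v : 'cV[R]_k) : R := (v^T *m v) 0 0.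

Lemma sqnormE k (v : 'cV[R]_k) : sqnorm v = \sum_i v i 0 ^+ 2.
Proof. by rewrite /sqnorm mxE; apply: eq_bigr => i _; rewrite mxE expr2. Qed.

Lemma sqnorm_ge0 k (v : 'cV[R]_k) : 0 <= sqnorm v.
Proof. by rewrite sqnormE sumr_ge0 // => i _; rewrite sqr_ge0. Qed.

Lemma sqnorm_eq0 k (v : 'cV[R]_k) : (sqnorm v == 0) = (v == 0).
Proof.
rewrite sqnormE psumr_eq0; last by move=> i _; rewrite sqr_ge0.
apply/allP/eqP => [v0|-> i _]; last by rewrite mxE expr0n eqxx.
apply/matrixP => i j; rewrite ord1 mxE; apply/eqP.
by rewrite -sqrf_eq0; apply: v0; rewrite mem_index_enum.
Qed.

Lemma quad_formE k (A : 'M[R]_k) (v : 'cV[R]_k) :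
  quad_form A v = \sum_i \sum_j A i j * (v i 0 * v j 0).
Proof.
rewrite /quad_form -mulmxA mxE; apply: eq_bigr => i _; rewrite !mxE mulr_sumr.
by apply: eq_bigr => j _; rewrite mulrCA.
Qed.

Lemma quad_formN k (A : 'M[R]_k) v : quad_form (- A) v = - quad_form A v.
Proof. by rewrite /quad_form mulmxN mulNmx mxE. Qed.

Lemma quad_formZ k (A : 'M[R]_k) (c : R) v : quad_form A (c *: v) = c ^+ 2 * quad_form A v.
Proof.
by rewrite /quad_form [(c *: v)^T]linearZ /= -!scalemxAl -scalemxAr scalerA mxE expr2.
Qed.

Lemma sqnormZ k (c : R) (v : 'cV[R]_k) : sqnorm (c *: v) = c ^+ 2 * sqnorm v.
Proof. by rewrite !sqnormE mulr_sumr; apply: eq_bigr => i _; rewrite mxE exprMn. Qed.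

Lemma quad_form_shift k (A : 'M[R]_k) (c : R) v :
  quad_form (A - c%:M) v = quad_form A v - c * sqnorm v.
Proof.
by rewrite /quad_form mulmxBr mulmxBl mul_mx_scalar -scalemxAl /sqnorm !mxE.
Qed.

(** Each product [v i 0 * v j 0] is at most [sqnorm v] in absolute value. The crude constant bounds
    the form of an inverse matrix and, through [- A], provides a lower bound for the form of [A]. *)
Lemma quad_form_le k (A : 'M[R]_k) v :
  quad_form A v <= (\sum_i \sum_j `|A i j|) * sqnorm v.
Proof.
rewrite quad_formE mulr_suml ler_sum // => i _.
rewrite mulr_suml ler_sum // => j _.
apply: le_trans (ler_norm _) _; rewrite normrM ler_wpM2l //.
have le_sqn (l : 'I_k) : v l 0 ^+ 2 <= sqnorm v.
  by rewrite sqnormE (bigD1 l) //= lerDl sumr_ge0 // => a _; rewrite sqr_ge0.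
have [hi hj] := (le_sqn i, le_sqn j).
have := sqr_ge0 (v i 0 + v j 0); have := sqr_ge0 (v i 0 - v j 0).
by rewrite ler_norml !expr2 in hi hj * => ? ?; apply/andP; split; lra.
Qed.

Lemma quad_form_ge k (A : 'M[R]_k) v :
  - (\sum_i \sum_j `|A i j|) * sqnorm v <= quad_form A v.
Proof.
have := quad_form_le (- A) v; rewrite quad_formN.
under eq_bigr => i _ do under eq_bigr => j _ do rewrite mxE normrN.
by rewrite mulNr => h; rewrite lerNl.
Qed.

(* Evaluating the form at [v - K^-1 B^-1 v], with [K] a bound for [B^-1], avoids any
   compactness argument. *)
Lemma psd_unitmx_coercive k (B : 'M[R]_k) : psd B -> B \in unitmx ->
  exists2 e : R, 0 < e & forall v, e * sqnorm v <= quad_form B v.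
Proof.
move=> [Bsym Bge0] Bu; set K := 1 + \sum_i \sum_j `|invmx B i j|.
have K_gt0 : 0 < K by rewrite ltr_pwDl // sumr_ge0 // => i _; rewrite sumr_ge0.
exists K^-1; rewrite ?invr_gt0 // => v.
have := Bge0 (v - K^-1 *: (invmx B *m v)).
have := quad_form_le (invmx B) v.
have symV : (invmx B)^T = invmx B by rewrite trmx_inv Bsym.
have -> : ((v - K^-1 *: (invmx B *m v))^T *m B *m (v - K^-1 *: (invmx B *m v))) 0 0
   = quad_form B v - 2 * K^-1 * sqnorm v + K^-1 ^+ 2 * quad_form (invmx B) v.
  rewrite [(_ - _)^T]linearB /= [(_ *: _)^T]linearZ /= trmx_mul symV.
  rewrite !(mulmxBl, mulmxBr) -!scalemxAl -!scalemxAr.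
  rewrite -[v^T *m invmx B *m B]mulmxA mulVmx // mulmx1.
  rewrite -[v^T *m B *m (_ *m v)]mulmxA mulKVmx //.
  rewrite /quad_form /sqnorm [v^T *m (_ *m v)]mulmxA !mxE; ring.
have := sqnorm_ge0 v; move: (sqnorm v) (quad_form B v) (quad_form _ v).
move=> s b c s0 hc hb.
(* Half of the cross term [2 * K^-1 * s] pays for this term; the other half is the coercivity
   bound. *)
have {}hc : K^-1 ^+ 2 * c <= K^-1 * s.
  rewrite expr2 -mulrA ler_pM2l ?invr_gt0 // ler_pdivrMl //.
  by apply: le_trans hc _; rewrite ler_wpM2r // lerDr.
lra.
Qed.

(* If [A - sup E] were invertible, its coercivity would push the supremum further. *)
Lemma symmetric_min_eigenvalue k (A : 'M[R]_k) : (0 < k)%N -> symmetric_mx A ->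
  exists2 a, eigenvalue A a & forall v, a * sqnorm v <= quad_form A v.
Proof.
case: k A => // k A _ Asym.
pose E : set R := [set a | forall v : 'cV_k.+1, a * sqnorm v <= quad_form A v]%classic.
have En0 : nonempty E by eexists => v; exact: quad_form_ge.
pose e0 : 'cV[R]_k.+1 := delta_mx ord0 0.
have ne0 : 0 < sqnorm e0.
  rewrite lt_neqAle sqnorm_ge0 andbT eq_sym sqnorm_eq0.
  by apply/eqP => /matrixP/(_ ord0 0)/eqP; rewrite !mxE !eqxx oner_eq0.
have Eub : has_ubound E.
  by exists (quad_form A e0 / sqnorm e0) => a /(_ e0); rewrite ler_pdivlMr.
(* Each nonzero [v] bounds [E] above by its Rayleigh quotient, and the supremum respects every such
   bound. *)
have EsupE : E (sup E).
  move=> v; have [v0|vn0] := eqVneq (sqnorm v) 0.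
    have [a Ea] := En0; have := Ea v.
    by rewrite v0 !mulr0.
  have v_gt0 : 0 < sqnorm v by rewrite lt_neqAle eq_sym vn0 sqnorm_ge0.
  by rewrite -ler_pdivlMr //; apply: ge_sup => // a /(_ v); rewrite ler_pdivlMr.
exists (sup E); last exact: EsupE.
rewrite /eigenvalue /eigenspace kermx_eq0 row_free_unit; apply/negP => Au.
have Bpsd : psd (A - (sup E)%:M).
  split; first by rewrite /symmetric_mx linearB /= tr_scalar_mx Asym.
  by move=> v; rewrite -[_ 0 0]/(quad_form _ v) quad_form_shift subr_ge0.
have [e e_gt0 he] := psd_unitmx_coercive Bpsd Au.
have Ee : E (sup E + e).
  by move=> v; have := he v; rewrite quad_form_shift lerBrDl mulrDl.
have := ub_le_sup Eub Ee; rewrite gerDl => /(lt_le_trans e_gt0).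
by rewrite ltxx.
Qed.

Lemma eigenvector_sqnorm1 k (A : 'M[R]_k) a : symmetric_mx A -> eigenvalue A a ->
  exists2 u : 'cV[R]_k, sqnorm u = 1 & quad_form A u = a.
Proof.
move=> Asym /eigenvalueP[v vA vn0].
have s_gt0 : 0 < sqnorm v^T.
  by rewrite lt_neqAle sqnorm_ge0 andbT eq_sym sqnorm_eq0 trmx_eq0.
have sn : (Num.sqrt (sqnorm v^T))^-1 ^+ 2 * sqnorm v^T = 1.
  by rewrite exprVn sqr_sqrtr ?sqnorm_ge0 // mulVf // gt_eqF.
exists ((Num.sqrt (sqnorm v^T))^-1 *: v^T); first by rewrite sqnormZ.
rewrite quad_formZ /quad_form trmxK vA -scalemxAl mxE -/(sqnorm _).
by rewrite -{2}[v]trmxK mulrCA -/(sqnorm _) sn mulr1.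
Qed.

(** Every eigenvalue is the value of the form at a unit eigenvector, so the eigenvalue bounding the
    form from below is the least one and the infimum in [lambda_min] is attained. *)
Lemma lambda_minP k (A : 'M[R]_k) : (0 < k)%N -> symmetric_mx A ->
  eigenvalue A (lambda_min A) /\ forall v, lambda_min A * sqnorm v <= quad_form A v.
Proof.
move=> k_gt0 Asym; have [a Aa lea] := symmetric_min_eigenvalue k_gt0 Asym.
suff -> : lambda_min A = a by [].
have lb_a : lbound [set b : R | eigenvalue A b]%classic a.
  move=> b /= /(eigenvector_sqnorm1 Asym)[u nu <-].
  by rewrite -[a]mulr1 -nu.
apply/le_anti/andP; split; first by apply: ge_inf => //; exists a.
by apply: lb_le_inf => //; exists a.
Qed.

Lemma psd_congruence k l (A : 'M[R]_k) (C : 'M[R]_(k, l)) : psd A -> psd (C^T *m A *m C).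
Proof.
move=> [Asym Age0]; split; first by rewrite /symmetric_mx !trmx_mul trmxK Asym mulmxA.
by move=> v; have := Age0 (C *m v); rewrite trmx_mul !mulmxA.
Qed.

Lemma psd_mxsub k l (A : 'M[R]_k) (f : 'I_l -> 'I_k) : psd A -> psd (mxsub f f A).
Proof.
move=> /(psd_congruence (colsub f 1%:M)).
by rewrite trmx_mxsub trmx1 mul_rowsub_mx mul1mx mulmx_colsub mulmx1 -mxsub_comp.
Qed.

Lemma psd_scale k (c : R) (A : 'M[R]_k) : 0 < c -> psd (c *: A) -> psd A.
Proof.
move=> c_gt0 [sym ge0]; have cn0 := lt0r_neq0 c_gt0; split.
  by move: sym; rewrite /symmetric_mx linearZ /= => /(scalerI cn0).
by move=> v; have := ge0 v; rewrite -scalemxAr -scalemxAl mxE pmulr_rge0.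
Qed.

Lemma psd_tens_outer k l (u : 'cV[R]_k) (A : 'M[R]_l) : psd A -> psd ((u *m u^T) *t A).
Proof.
move=> Apsd.
(* [C] is the Kronecker product of [u^T] and the identity, written entrywise. *)
pose C : 'M[R]_(l, k * l) := \matrix_(a, b)
  (u (mxtens_unindex b).1 0 * (a == (mxtens_unindex b).2)%:R).
suff -> : (u *m u^T) *t A = C^T *m A *m C by apply: psd_congruence.
apply/matrixP => i j; rewrite -[i]mxtens_unindexK -[j]mxtens_unindexK.
case: (mxtens_unindex i) (mxtens_unindex j) => [a b] [c d]; rewrite tensmxE !mxE.
rewrite big_ord1 (bigD1 d) //= big1 ?addr0 => [|e /negPf ned].
  rewrite !mxE mxtens_indexK eqxx (bigD1 b) //= big1 ?addr0 => [|e /negPf neb].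
    by rewrite !mxE mxtens_indexK eqxx !mulr1 mulrAC.
  by rewrite !mxE mxtens_indexK /= neb mulr0 mul0r.
by rewrite !mxE mxtens_indexK /= ned !mulr0.
Qed.

(** The rank factorization has inner dimension 1, so [M] is a column times a row. *)
Lemma rank1_minors m n (M : 'M[R]_(m, n)) i j k l :
  \rank M = 1%N -> M i j * M k l = M i l * M k j.
Proof.
rewrite -{2 3 4 5}(mulmx_base M); move: (col_base M) (row_base M) => + + rk.
by rewrite rk => u v; rewrite !mxE !big_ord1 mulrACA [X in _ * X]mulrC mulrACA.
Qed.

(** The bound is applied to the columns of [P] and summed. For a symmetric projection of trace 1 it
    says that [c] is at most the trace of [A *m P]. *)
Lemma mxtrace_congruence_ge k (A P : 'M[R]_k) c :
  (forall v, c * sqnorm v <= quad_form A v) ->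
  c * \tr (P^T *m P) <= \tr (P^T *m A *m P).
Proof.
move=> geA; rewrite /mxtrace mulr_sumr ler_sum // => j _.
have diagE (B : 'M[R]_k) : B j j = quad_form B (delta_mx j 0).
  by rewrite /quad_form trmx_delta -rowE -colE !mxE.
have := geA (P *m delta_mx j 0).
by rewrite /sqnorm /quad_form trmx_mul !mulmxA !diagE /quad_form !mulmxA.
Qed.

End QuadraticForms.

(** * Evaluation and factorization of monomials *)

Section MonomialEvaluation.
Set Implicit Arguments.
Unset Strict Implicit.
Variables (R : realType) (n : nat).
Implicit Types (x : 'rV[R]_n) (a b : 'X_{1..n}).

Definition mnm_eval x a : R := ('X_[a] : {mpoly R[n]}).@[x 0].

Lemma mnm_evalD x a b : mnm_eval x (a + b)%MM = mnm_eval x a * mnm_eval x b.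
Proof. by rewrite /mnm_eval mpolyXD mevalM. Qed.

Lemma mnm_eval0 x : mnm_eval x 0%MM = 1.
Proof. by rewrite /mnm_eval mpolyX0 meval1. Qed.

Lemma mnm_evalU x i : mnm_eval x U_(i)%MM = x 0 i.
Proof. by rewrite /mnm_eval mevalXU. Qed.

Lemma pmx_coeff_mdeg k (A : 'M[{mpoly R[n]}]_k) a :
  pmx_coeff A a != 0 -> (mdeg a <= pmx_deg A)%N.
Proof.
move=> An0; have [i [j Aij]] : exists i j, (A i j)@_a != 0.
  apply: contrapT => h; case/negP: An0; apply/eqP/matrixP => i j; rewrite !mxE.
  by apply/eqP/negPn/negP => hij; apply: h; exists i, j.
apply: leq_trans (leq_bigmax i); apply: leq_trans (leq_bigmax j).
rewrite -mcoeff_msupp in Aij; have := msize_mdeg_lt Aij.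
by rewrite /=; case: (msize _).
Qed.

Lemma pmx_eval_sum k (A : 'M[{mpoly R[n]}]_k) x d : (pmx_deg A <= d)%N ->
  pmx_eval A x = \sum_(c : 'X_{1..n < d.+1}) mnm_eval x c *: pmx_coeff A c.
Proof.
move=> le_d; apply/matrixP => i j; rewrite mxE summxE.
(* [leqSpred] also covers the zero polynomial, whose size and degree are both 0. *)
have szA : (msize (A i j) <= d.+1)%N.
  apply: leq_trans (leqSpred _) _; rewrite ltnS; apply: leq_trans le_d.
  apply: leq_trans (leq_bigmax i).
  apply: (leq_bigmax (F := fun j => (msize (A i j)).-1) j).
rewrite {1}(mpolywE szA) raddf_sum; apply: eq_bigr => c _.
by rewrite /= mevalZ !mxE mulrC.
Qed.

Lemma pmx_eval_sym k (A : 'M[{mpoly R[n]}]_k) x :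
  symmetric_mx A -> symmetric_mx (pmx_eval A x).
Proof.
by move=> /matrixP Asym; apply/matrixP => i j; have := Asym i j; rewrite !mxE => ->.
Qed.

Lemma mnm_neq0_split a : a != 0%MM -> exists i b, a = (U_(i) + b)%MM.
Proof.
move=> an0; have [i ai] : exists i, a i != 0%N.
  apply: contrapT => h; case/negP: an0; apply/eqP/mnmP => i; rewrite mnm0E.
  by apply/eqP/negPn/negP => hi; apply: h; exists i.
exists i, (a - U_(i))%MM; rewrite addmC submK //; apply/mnm_lepP => j.
by rewrite mnm1E; case: eqP => // <-; rewrite lt0n.
Qed.

(** Variables are moved across one at a time. A monomial of degree between [d] and [2 * d] thus
    factors into two of degree at most [d], both of which index blocks of the moment matrix of order
    [d]. *)
Lemma mnm_split a d : (d <= mdeg a)%N ->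
  exists b c, a = (b + c)%MM /\ mdeg b = d.
Proof.
elim: d => [_|d IH lt_d]; first by exists 0%MM, a; rewrite add0m mdeg0.
have [b [c [eq_a eq_b]]] := IH (ltnW lt_d).
have /mnm_neq0_split[i [c' eq_c]] : c != 0%MM.
  by apply: contraTneq lt_d => c0; rewrite eq_a c0 addm0 eq_b ltnn.
exists (b + U_(i))%MM, c'; rewrite eq_a eq_c addmA; split=> //.
by rewrite mdegD mdeg1 eq_b addn1.
Qed.

Lemma mnm_suppD a b : mnm_supp (a + b)%MM = mnm_supp a :|: mnm_supp b.
Proof. by apply/setP => i; rewrite !inE mnmDE addn_eq0 negb_and. Qed.

Lemma mnm_supp0 (I : {set 'I_n}) : mnm_supp (0%MM : 'X_{1..n}) \subset I.
Proof. by apply/fintype.subsetP => i; rewrite inE mnm0E. Qed.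

End MonomialEvaluation.

(** * Block matrices and their positive semidefiniteness *)

Section BlockMatrices.
Set Implicit Arguments.
Unset Strict Implicit.
Variable R : realType.

Lemma mxblock_entry (N k : nat) (B : 'I_N -> 'I_N -> 'M[R]_k) (a b : 'I_N) i j :
  B a b i j = (\mxblock_(a, b) B a b) (tagnat.Rank a i) (tagnat.Rank b j).
Proof. by have /matrixP/(_ i j) := mxblockK B a b; rewrite mxE. Qed.

Lemma psd_block (N k : nat) (B : 'I_N -> 'I_N -> 'M[R]_k) (a : 'I_N) :
  psd (\mxblock_(a, b) B a b) -> psd (B a a).
Proof.
by move=> /(psd_mxsub (tagnat.Rank a)); rewrite -[mxsub _ _ _]/(submxblock _ a a) mxblockK.
Qed.

(** The matrix is the congruence of [Q] by the block row of the scalar matrices [c a]. *)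
Lemma psd_mxblock_outer (N k : nat) (c : 'I_N -> R) (Q : 'M[R]_k) :
  psd Q -> psd (\mxblock_(a < N, b < N) ((c a * c b) *: Q)).
Proof.
move=> /(psd_congruence (\mxrow_(a < N) (c a)%:M)).
rewrite tr_mxrow -mulmxA mul_mxrow mul_mxcol_mxrow.
rewrite (_ : mxblock _ = mxblock (fun a b => ((c a * c b) *: Q))) //.
by apply: eq_mxblock => a b; rewrite tr_scalar_mx mul_scalar_mx mul_mx_scalar scalerA.
Qed.

End BlockMatrices.

(** * Moments, and what rank one forces on them *)

Section Moments.
Set Implicit Arguments.
Unset Strict Implicit.
Variables (R : realType) (n p r : nat) (S : moments R n p r).
Implicit Types (a b : 'X_{1..n}).

Lemma moment_bmnm (b : 'X_{1..n < (2 * r).+1}) : moment S b = S b.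
Proof. by rewrite /moment valK. Qed.

Lemma moment_sym a : (forall c, symmetric_mx (S c)) -> symmetric_mx (moment S a).
Proof.
by move=> Ssym; rewrite /moment; case: insubP => [b _ _|_] //; rewrite /symmetric_mx trmx0.
Qed.

(** Only the monomials occurring in [A] need moments of this form: under correlative sparsity,
    moments whose support lies in no clique are not controlled. *)
Lemma riesz_rank1 (A : 'M[{mpoly R[n]}]_p) x (P : 'M[R]_p) :
  (pmx_deg A <= 2 * r)%N ->
  (forall a, pmx_coeff A a != 0 -> moment S a = mnm_eval x a *: P) ->
  riesz S A = \tr (pmx_eval A x *m P).
Proof.
move=> degA SA; rewrite (pmx_eval_sum _ degA) mulmx_suml raddf_sum /=.
apply: eq_bigr => c _; have [->|An0] := eqVneq (pmx_coeff A c) 0.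
  by rewrite scaler0 !mul0mx.
by rewrite SA // -scalemxAr -scalemxAl.
Qed.

Lemma riesz1 : riesz S 1%:M = \tr (moment S 0%MM).
Proof.
have deg1 : pmx_deg (1%:M : 'M[{mpoly R[n]}]_p) = 0%N.
  apply/eqP; rewrite -leqn0; apply/bigmax_leqP => i _; apply/bigmax_leqP => j _.
  by rewrite mxE; case: eqP => _; rewrite ?msize0 ?msize1.
rewrite (@riesz_rank1 _ 0 (moment S 0%MM)) ?deg1 //; last first.
  move=> a /pmx_coeff_mdeg; rewrite deg1 leqn0 mdeg_eq0 => /eqP ->.
  by rewrite mnm_eval0 scale1r.
suff -> : pmx_eval (1%:M : 'M[{mpoly R[n]}]_p) 0 = 1%:M by rewrite mul1mx.
by rewrite /pmx_eval map_mx1.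
Qed.

(** This serves both directions: it reads off the (0, 0) block for the recovered point, and it
    computes every block for the moments of a feasible point. *)
Lemma localizing_block k (A : 'M[{mpoly R[n]}]_k) a x (P : 'M[R]_p) :
  (forall c, pmx_coeff A c != 0 -> moment S (a + c)%MM = mnm_eval x (a + c)%MM *: P) ->
  \sum_(c : 'X_{1..n < (pmx_deg A).+1}) (moment S (a + c)%MM *t pmx_coeff A c)
    = mnm_eval x a *: (P *t pmx_eval A x).
Proof.
move=> SA; apply/matrixP => i j.
rewrite -[i]mxtens_unindexK -[j]mxtens_unindexK.
case: (mxtens_unindex i) (mxtens_unindex j) => [i1 i2] [j1 j2].
rewrite summxE mxE tensmxE (pmx_eval_sum _ (leqnn _)) summxE !mulr_sumr.
apply: eq_bigr => c _; rewrite tensmxE.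
have [->|An0] := eqVneq (pmx_coeff A c) 0; first by rewrite !mxE !mulr0.
by rewrite SA // mnm_evalD !mxE; ring.
Qed.

Section RankOne.
Variables (d : nat) (I : {set 'I_n}).
Hypothesis rank1 : \rank (moment_mx S d I) = 1%N.

Lemma moment_minors (a b c e : 'X_{1..n}) i j k l :
  (mdeg a <= d)%N -> (mdeg b <= d)%N -> (mdeg c <= d)%N -> (mdeg e <= d)%N ->
  mnm_supp a \subset I -> mnm_supp b \subset I ->
  mnm_supp c \subset I -> mnm_supp e \subset I ->
  moment S (a + b)%MM i j * moment S (c + e)%MM k l =
  moment S (a + e)%MM i l * moment S (c + b)%MM k j.
Proof.
have idx f : (mdeg f <= d)%N -> mnm_supp f \subset I ->
    exists u : 'I_#|monomials d I|, f = enum_val u.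
  rewrite -ltnS => degf suppf; have fI : BMultinom degf \in monomials d I by rewrite inE.
  by exists (enum_rank_in fI (BMultinom degf)); rewrite enum_rankK_in.
move=> da db dc de sa sb sc se.
have [[ua ->] [ub ->]] := (idx a da sa, idx b db sb).
have [[uc ->] [ue ->]] := (idx c dc sc, idx e de se).
pose B (u v : 'I_#|monomials d I|) := moment S (enum_val u + enum_val v)%MM.
rewrite -!/(B _ _) !(mxblock_entry B); exact: rank1_minors.
Qed.

Hypothesis tr1 : \tr (moment S 0%MM) = 1.

(** The minor with rows [(a, i)], [(0, k)] and columns [(b, j)], [(0, k)] is summed over [k]: one
    side acquires the trace of [S_0], which is 1, and the other becomes a matrix product. *)
Lemma momentD a b : (mdeg a <= d)%N -> (mdeg b <= d)%N ->
  mnm_supp a \subset I -> mnm_supp b \subset I ->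
  moment S (a + b)%MM = moment S a *m moment S b.
Proof.
move=> da db sa sb; apply/matrixP => i j; rewrite mxE -[LHS]mulr1 -tr1 mulr_sumr.
apply: eq_bigr => k _; have := @moment_minors a b 0%MM 0%MM i j k k.
by rewrite !addm0 !add0m mdeg0 mnm_supp0; apply.
Qed.

(** By [momentD], [S_a = S_0 S_a]. Summing over [i] the minors with rows [(a, i)], [(0, k)] and
    columns [(0, i)], [(0, l)] turns this product into the trace of [S_a] times [S_0]. *)
Lemma moment_trace a : (mdeg a <= d)%N -> mnm_supp a \subset I ->
  moment S a = \tr (moment S a) *: moment S 0%MM.
Proof.
move=> da sa; have := @momentD 0%MM a; rewrite add0m mdeg0 mnm_supp0 => Sa.
rewrite {1}Sa //; apply/matrixP => k l; rewrite !mxE /mxtrace mulr_suml.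
apply: eq_bigr => i _; have := @moment_minors a 0%MM 0%MM 0%MM i i k l.
rewrite !addm0 mdeg0 mnm_supp0 => -> //; exact: mulrC.
Qed.

Lemma moment_idem : moment S 0%MM *m moment S 0%MM = moment S 0%MM.
Proof. by rewrite -momentD ?add0m // ?mdeg0 ?mnm_supp0. Qed.

Lemma moment_recovered a : (mdeg a <= 2 * d)%N -> mnm_supp a \subset I ->
  moment S a = mnm_eval (recovered_point S) a *: moment S 0%MM.
Proof.
(* Degrees up to [d] go by induction, one variable being split off; its moment is given by
   [moment_trace], whose scalar is a coordinate of the recovered point. *)
have low b : (mdeg b <= d)%N -> mnm_supp b \subset I ->
    moment S b = mnm_eval (recovered_point S) b *: moment S 0%MM.
  elim: {b}(mdeg b) {-2}b (erefl (mdeg b)) => [|e IH] b degb; rewrite degb.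
    by move/eqP: degb; rewrite mdeg_eq0 => /eqP -> _ _; rewrite mnm_eval0 scale1r.
  have /mnm_neq0_split[i [c eq_b]] : b != 0%MM by rewrite -mdeg_eq0 degb.
  move: degb; rewrite {}eq_b mdegD mdeg1 add1n => -[degc] led.
  rewrite mnm_suppD finset.subUset => /andP[sU sc].
  rewrite momentD ?mdeg1 ?degc ?(leq_ltn_trans _ led) // ?(ltnW led) //.
  rewrite (IH c) ?degc ?(ltnW led) // moment_trace ?mdeg1 ?(leq_ltn_trans _ led) //.
  by rewrite -scalemxAl -scalemxAr moment_idem scalerA mnm_evalD mnm_evalU mxE.
(* Above degree [d], the monomial is cut into a factor of degree exactly [d] and one of degree at
   most [d]. *)
move=> da sa; have [/low/(_ sa) //|/ltnW/mnm_split[b [c [eq_a degb]]]] := leqP (mdeg a) d.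
move: da sa; rewrite {}eq_a mdegD degb mul2n -addnn leq_add2l => degc.
rewrite mnm_suppD finset.subUset => /andP[sb sc].
rewrite momentD ?degb // (low b) ?degb // (low c) //.
by rewrite -scalemxAl -scalemxAr moment_idem scalerA mnm_evalD.
Qed.

End RankOne.
End Moments.

(** * Cliques of the correlative sparsity graph *)

Section Sparsity.
Set Implicit Arguments.
Unset Strict Implicit.
Variables (R : realType) (n m p t : nat) (q : 'I_m -> nat).
Variables (F : 'M[{mpoly R[n]}]_p) (G : forall k : 'I_m, 'M[{mpoly R[n]}]_(q k)).
Variable I : 'I_t -> {set 'I_n}.
Hypothesis I_cliques : enumerates_maximal_cliques F G I.

(** The vertex set is finite, so a clique extends to one that is maximal for inclusion. *)
Lemma clique_cover (C : {set 'I_n}) : csp_clique F G C -> exists l, C \subset I l.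
Proof.
move=> Cc; pose P : pred {set 'I_n} := fun D => `[< csp_clique F G D >].
have [D /maxsetP[/asboolP Dc maxD] CD] := maxset_exists (P := P) (asboolT Cc).
have /(proj2 I_cliques)[l DI] : csp_maximal_clique F G D.
  by split=> // E Ec /maxD -> //; apply/asboolP.
by exists l; rewrite -DI.
Qed.

(** With [clique_cover], each monomial of [F] falls in some [I l], where the rank condition controls
    its moment. *)
Lemma supp_clique a : pmx_coeff F a != 0 -> csp_clique F G (mnm_supp a).
Proof. by move=> Fa i j ia ja neq_ij; split=> //; left; exists a. Qed.

(** With [clique_cover], it guarantees that at least one index [l] exists, even for [n = 0]. *)
Lemma clique_set0 : csp_clique F G finset.set0.
Proof. by move=> i j; rewrite inE. Qed.

End Sparsity.

(** * Moments of a point mass *)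

Section RankOneMoments.
Set Implicit Arguments.
Unset Strict Implicit.
Variables (R : realType) (n p r : nat) (x : 'rV[R]_n) (P : 'M[R]_p).

(** These are the truncated moments of the Dirac measure at [x] with matrix weight [P]. *)
Definition point_moments : moments R n p r :=
  [ffun a : 'X_{1..n < (2 * r).+1} => mnm_eval x a *: P].

Lemma moment_point a : (mdeg a <= 2 * r)%N -> moment point_moments a = mnm_eval x a *: P.
Proof.
move=> da; rewrite -[a]/(bmnm (BMultinom (da : (mdeg a < (2 * r).+1)%N))).
by rewrite moment_bmnm ffunE.
Qed.

End RankOneMoments.

(** * The relaxation bounds the problem from below *)

Section Relaxation.
Set Implicit Arguments.
Unset Strict Implicit.
Variables (R : realType) (n m p t : nat) (q : 'I_m -> nat).
Variables (F : 'M[{mpoly R[n]}]_p) (G : forall k : 'I_m, 'M[{mpoly R[n]}]_(q k)).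
Variables (I : 'I_t -> {set 'I_n}) (J : 'I_t -> {set 'I_m}) (r : nat).
Hypothesis r_ge : (r_min F G <= r)%N.

Lemma half_deg_le k : (half_deg G k <= r_min F G)%N.
Proof. by rewrite /r_min leq_max (leq_bigmax k) orbT. Qed.

Lemma leq_uphalf2 d e : (uphalf d <= e)%N -> (d <= 2 * e)%N.
Proof. by rewrite leq_uphalf_double mul2n. Qed.

Lemma deg_F_le : (pmx_deg F <= 2 * r_min F G)%N.
Proof. by apply: leq_uphalf2; rewrite leq_maxl. Qed.

(** With [w] the vector of monomial values at [x], the moment matrices are blockwise [w w^T]
    tensored with [u u^T], and the localizing ones [w w^T] tensored with [u u^T] and [G_k(x)]. *)
Lemma point_moments_feasible x (u : 'cV[R]_p) : sqnorm u = 1 -> feasible G x ->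
  cs_feasible G I J (point_moments r x (u *m u^T)).
Proof.
move=> u1 feas_x; set S := point_moments r x _.
have uu_sym : symmetric_mx (u *m u^T) by rewrite /symmetric_mx trmx_mul trmxK.
have uu_psd : psd (u *m u^T).
  split=> // v; rewrite mulmxA -mulmxA -[v^T *m u]trmxK trmx_mul trmxK.
  by rewrite -[_ 0 0]/(sqnorm _) sqnorm_ge0.
have mdeg_enum d l (a : 'I_#|monomials d (I l)|) : (mdeg (enum_val a) <= d)%N.
  by rewrite -ltnS; exact: bmdeg.
split.
- by move=> a; rewrite /symmetric_mx ffunE linearZ /= uu_sym.
- move=> l; rewrite /moment_mx.
  under eq_mxblock => a b.
    rewrite moment_point ?mnm_evalD; last by rewrite mdegD mul2n -addnn leq_add.
    over.
  exact: psd_mxblock_outer.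
- move=> l k _; rewrite /localizing_mx.
  under eq_mxblock => a b.
    rewrite (@localizing_block _ _ _ _ _ _ _ _ x (u *m u^T)) ?mnm_evalD; last first.
      (* The two block indices have degree at most [r - d_k] and [c] at most [2 d_k]. Since
         [d_k <= r], the sum stays within [2 r], where [moment] has not yet fallen to its default
         0. *)
      move=> c /pmx_coeff_mdeg degc; rewrite moment_point // !mdegD.
      have := leq_trans (half_deg_le k) r_ge; move: degc.
      have := leq_uphalf2 (leqnn (half_deg G k)).
      have := mdeg_enum _ _ a; have := mdeg_enum _ _ b; lia.
    over.
  by apply: psd_mxblock_outer; apply: psd_tens_outer.
- by rewrite riesz1 moment_point ?mdeg0 // mnm_eval0 scale1r mxtrace_mulC trace_mx11.
Qed.

Lemma riesz_point_moments x (u : 'cV[R]_p) :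
  riesz (point_moments r x (u *m u^T)) F = quad_form (pmx_eval F x) u.
Proof.
have degF : (pmx_deg F <= 2 * r)%N.
  by apply: leq_trans deg_F_le _; rewrite leq_pmul2l.
rewrite (riesz_rank1 degF (x := x) (P := u *m u^T)).
  by rewrite mulmxA mxtrace_mulC mulmxA trace_mx11.
by move=> a /pmx_coeff_mdeg dega; rewrite moment_point // (leq_trans dega).
Qed.

Lemma lambda_cs_le : (0 < p)%N -> symmetric_mx F ->
  (lambda_cs F G I J r <= lambda_star F G)%E.
Proof.
move=> p_gt0 F_sym; apply: le_ereal_inf_tmp => _ [x feas_x <-].
have Fx_sym := pmx_eval_sym x F_sym.
have [ev _] := lambda_minP p_gt0 Fx_sym.
have [u u1 <-] := eigenvector_sqnorm1 Fx_sym ev.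
apply: ereal_inf_lbound; exists (point_moments r x (u *m u^T)).
  exact: point_moments_feasible.
by rewrite riesz_point_moments.
Qed.

End Relaxation.

Theorem corollary5p5 (R : realType) (n m p t : nat) (q : 'I_m -> nat)
    (F : 'M[{mpoly R[n]}]_p)
    (G : forall k : 'I_m, 'M[{mpoly R[n]}]_(q k))
    (I : 'I_t -> {set 'I_n}) (J : 'I_t -> {set 'I_m})
    (r : nat) (S : moments R n p r)
    (p_gt0 : (0 < p)%N)
    (F_sym : symmetric_mx F)
    (G_sym : forall k, symmetric_mx (G k))
    (I_cliques : enumerates_maximal_cliques F G I)
    (J_assign : constraint_assignment G I J)
    (r_ge : (r_min F G <= r)%N)
    (S_opt : cs_optimal F G I J S)
    (rank1 : forall l, \rank (moment_mx S (r_min F G) (I l)) = 1%N) :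
  lambda_cs F G I J r = lambda_star F G /\
  optimal_point F G (recovered_point S).
Proof.
have [[S_sym M_psd L_psd S_tr] S_val] := S_opt.
set x := recovered_point S; pose P := moment S 0%MM.
have trP : \tr P = 1 by rewrite -riesz1.
have P_sym : P^T = P := moment_sym 0%MM S_sym.
(* Some clique is needed to apply the rank condition to [S_0]. *)
have [l0 _] := clique_cover I_cliques (@clique_set0 _ _ _ _ _ F G).
have PP : P *m P = P := moment_idem (rank1 l0) trP.
(* Neither [x] nor [P] depends on [l], so the descriptions on different cliques agree without
   gluing. *)
have S_rank1 l a : (mdeg a <= 2 * r_min F G)%N -> mnm_supp a \subset I l ->
  moment S a = mnm_eval x a *: P by exact: moment_recovered (rank1 l) trP _.
have feas_x : feasible G x.
  move=> k; have [_ J_cover J_occurs] := J_assign.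
  have /bigcupP[l _ Jlk] : k \in \bigcup_(l < t) J l by rewrite J_cover inE.
  have zero_mem : bm0 \in monomials (r - half_deg G k) (I l).
    by rewrite inE mnm_supp0.
  have := L_psd l k Jlk; rewrite /localizing_mx.
  move=> /(psd_block (enum_rank_in zero_mem bm0)).
  rewrite enum_rankK_in // (@localizing_block _ _ _ _ _ _ _ _ x P).
    rewrite addm0 mnm_eval0 scale1r => PG_psd.
    (* The diagonal entries of [P = P^T P] are sums of squares and add up to 1. *)
    have [i Pi] : exists i, 0 < P i i.
      have P_ge0 i : 0 <= P i i.
        rewrite -PP -{1}P_sym mxE sumr_ge0 // => j _.
        by rewrite mxE -expr2 sqr_ge0.
      apply: contrapT => no_i; have := oner_neq0 R; rewrite -trP.
      rewrite /mxtrace big1 ?eqxx // => i _; apply/le_anti; rewrite P_ge0 andbT leNgt.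
      by apply/negP => Pi; apply: no_i; exists i.
    apply: (psd_scale Pi).
    (* The rows and columns [(i, j)], with [i] fixed, cut [P i i *: G_k(x)] out of the Kronecker
       product. *)
    have := psd_mxsub (fun j => mxtens_index (i, j)) PG_psd.
    congr psd; apply/matrixP => a b.
    by rewrite !mxE !mxtens_indexK.
  (* A monomial of [G_k] has degree at most [2 d_k], and its variables lie in the clique to which
     [k] is assigned. *)
  move=> c Gc; rewrite !add0m; apply: (S_rank1 l).
    apply: leq_trans (pmx_coeff_mdeg Gc) _; apply: leq_uphalf2.
    exact: half_deg_le.
  apply/fintype.subsetP => i ci; apply: (J_occurs _ k) => //.
  by exists c.
have val_ge : lambda_min (pmx_eval F x) <= riesz S F.
  rewrite (riesz_rank1 (x := x) (P := P)).
  - have [_ lminP] := lambda_minP p_gt0 (pmx_eval_sym x F_sym).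
    have := mxtrace_congruence_ge P lminP.
    by rewrite P_sym PP trP mulr1 mxtrace_mulC mulmxA PP mxtrace_mulC.
  - by apply: leq_trans (deg_F_le F G) _; rewrite leq_pmul2l.
  move=> a Fa; have [l al] := clique_cover I_cliques (supp_clique G Fa).
  by apply: (S_rank1 l) => //; apply: leq_trans (pmx_coeff_mdeg Fa) (deg_F_le F G).
have star_le : (lambda_star F G <= (lambda_min (pmx_eval F x))%:E)%E.
  by apply: ereal_inf_lbound; exists x.
have cs_le := lambda_cs_le I J r_ge p_gt0 F_sym.
have cs_ge : ((lambda_min (pmx_eval F x))%:E <= lambda_cs F G I J r)%E.
  by rewrite -S_val lee_fin.
(* The value at [x] lies above [lambda_star] and below [lambda_cs], itself at most [lambda_star];
   the cycle makes all three equal. *)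
split; [|split=> //]; apply/le_anti/andP; split=> //.
- exact: le_trans star_le cs_ge.
- exact: le_trans cs_ge cs_le.
Qed.
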